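(* Let $R$ be an associative ring with identity, $M$ a regular right $R$-module, and $m_1,m_2\in M$. Then $m_1\leq^{-}m_2$ if and only if $m_1\leq_{M}m_2$.
   Context: Rings are associative with identity, and modules are unitary right modules. For a right $R$-module $M$, let $S=\mathrm{End}_R(M)$ and $M^*=\mathrm{Hom}_R(M,R)$. For $m\in M$ and $\varphi\in M^*$, write $\varphi m:=\varphi(m)\in R$, and let $m\varphi\in S$ denote the endomorphism $x\mapsto m\,\varphi(x)$ of $M$. An element $m\in M$ is (Zelmanowitz) regular if $m=m\varphi m$, i.e. $m=m\,\varphi(m)$, for some $\varphi\in M^*$. The module $M$ is regular if every element of $M$ is regular. Minus order: for $m_1,m_2\in M$, $m_1\leq^{-}m_2$ means that there exists $\varphi\in M^*$ such that $m_1=m_1\varphi m_1$, $m_1\varphi=m_2\varphi$ (in $S$), and $\varphi m_1=\varphi m_2$ (in $R$). Relation $\leq_M$ (the subscript is just a name, after Mitsch): for $m_1,m_2\in M$, $m_1\leq_M m_2$ means that there exist $f\in S$ and $a\in R$ (not required to be idempotent) such that $m_1=m_2a=fm_2$ and $m_1=fm_1$. *)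

(* Defs.v *)
From HB Require Import structures.
From mathcomp Require Import all_boot all_order all_algebra.
Set Implicit Arguments.
Unset Strict Implicit.
Unset Printing Implicit Defensive.
Import GRing.Theory.
Local Open Scope ring_scope.

(* A right R-module is a left module over the converse ring R^c: for          *)
(* M : lmodType R^c, the right action of a on m is a *: m.                    *)
(* pzRingType (rather than nzRingType) keeps the zero ring.                   *)
Notation rmodType R := (lmodType R^c).

Definition ract (R : pzRingType) (M : rmodType R) (m : M) (a : R) : M :=
  (a : R^c) *: m.

Notation "m *> a" := (ract m a) (at level 40, left associativity) : ring_scope.

Lemma ractA (R : pzRingType) (M : rmodType R) (m : M) (a b : R) :
  m *> a *> b = m *> (a * b).
Proof. exact: scalerA. Qed.

Notation endo M := {linear M -> M}.

(* M^* = Hom_R(M, R_R); the right module R_R is the regular module of R^c.    *)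
Definition dual (R : pzRingType) (M : rmodType R) : Type :=
  {linear M -> (R^c)^o}.

Definition dapp (R : pzRingType) (M : rmodType R) (phi : dual M) (m : M) : R :=
  (phi : {linear M -> (R^c)^o}) m.

Lemma dapp_ract (R : pzRingType) (M : rmodType R) (phi : dual M) (m : M)
  (a : R) : dapp phi (m *> a) = dapp phi m * a.
Proof. by rewrite /dapp /ract linearZ. Qed.

Lemma dappD (R : pzRingType) (M : rmodType R) (phi : dual M) (m n : M) :
  dapp phi (m + n) = dapp phi m + dapp phi n.
Proof. by rewrite /dapp linearD. Qed.

Definition outer (R : pzRingType) (M : rmodType R) (m : M) (phi : dual M)
  (x : M) : M := m *> dapp phi x.

Lemma outer_is_linear (R : pzRingType) (M : rmodType R) (m : M)
  (phi : dual M) : linear (outer m phi).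
Proof.
move=> a x y; rewrite /outer dappD -[a *: x]/(x *> a) dapp_ract.
by rewrite /ract scalerDl scalerA.
Qed.

HB.instance Definition _ (R : pzRingType) (M : rmodType R) (m : M)
    (phi : dual M) :=
  GRing.isLinear.Build R^c M M *:%R (outer m phi) (outer_is_linear m phi).

Definition regular_elt (R : pzRingType) (M : rmodType R) (m : M) : Prop :=
  exists phi : dual M, m = m *> dapp phi m.

Definition regular_module (R : pzRingType) (M : rmodType R) : Prop :=
  forall m : M, regular_elt m.

(* S = End_R(M) is endo M, with equality taken extensionally (=1).            *)
Definition minus_le (R : pzRingType) (M : rmodType R) (m1 m2 : M) : Prop :=
  exists phi : dual M,
    [/\ m1 = m1 *> dapp phi m1,
        (outer m1 phi : endo M) =1 (outer m2 phi : endo M)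
      & dapp phi m1 = dapp phi m2].

Definition mitsch_le (R : pzRingType) (M : rmodType R) (m1 m2 : M) : Prop :=
  exists (f : endo M) (a : R),
    [/\ m1 = m2 *> a, m1 = f m2 & m1 = f m1].

(* Main.v *)
(* If m1 = m2 a = f m2 = f m1, then m1 a = f (m2 a) = m1; so, for any psi with
   m1 = m1 psi(m1), the functional x |-> a psi(f x) witnesses the minus order.
   Conversely, a minus-order witness phi gives f = m1 phi and a = phi(m1). *)
From HB Require Import structures.
Require Import Defs.
From mathcomp Require Import all_boot all_order all_algebra.
Set Implicit Arguments.
Unset Strict Implicit.
Unset Printing Implicit Defensive.
Import GRing.Theory.
Local Open Scope ring_scope.

Definition dual_comp (R : pzRingType) (M : rmodType R) (a : R) (psi : dual M)
  (f : endo M) (x : M) : (R^c)^o := a * dapp psi (f x).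

(** Left multiplication by [a] commutes with the right action of [R] on itself. *)
Lemma dual_comp_is_linear (R : pzRingType) (M : rmodType R) (a : R)
  (psi : dual M) (f : endo M) : linear (dual_comp a psi f).
Proof.
move=> c x y; rewrite /dual_comp linearD linearZ /= dappD.
by rewrite -[c *: f x]/(ract (f x) c) dapp_ract mulrDr mulrA.
Qed.

HB.instance Definition _ (R : pzRingType) (M : rmodType R) (a : R)
    (psi : dual M) (f : endo M) :=
  GRing.isLinear.Build R^c M (R^c)^o *:%R (dual_comp a psi f)
    (dual_comp_is_linear a psi f).

Lemma minus_le_mitsch_le (R : pzRingType) (M : rmodType R) (m1 m2 : M) :
  minus_le m1 m2 -> mitsch_le m1 m2.
Proof.
case=> phi [m1E outerE phiE]; exists (outer m1 phi : endo M), (dapp phi m1).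
split; [|by rewrite /= /outer -phiE|exact: m1E].
(* Evaluating [outerE] at [m1] turns [m1 *> dapp phi m1] into [m2 *> dapp phi m1]. *)
by rewrite {1}m1E; exact: outerE.
Qed.

Lemma mitsch_le_minus_le (R : pzRingType) (M : rmodType R) (m1 m2 : M) :
  regular_elt m1 -> mitsch_le m1 m2 -> minus_le m1 m2.
Proof.
case=> psi m1psi [f [a [m1a m1f2 m1f1]]].
have m1aE : ract m1 a = m1.
  by rewrite {1}m1f2 [RHS]m1f1 [in RHS]m1a /ract linearZ.
exists (dual_comp a psi f : dual M); split.
- by rewrite /dapp /= /dual_comp -m1f1 -ractA m1aE.
(* Acting by [a] sends both [m1] and [m2] to [m1], so both sides are [m1 *> dapp psi (f x)]. *)
- by move=> x; rewrite /= /outer /dapp /= /dual_comp -!ractA m1aE -m1a.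
(* Likewise [f] sends both to [m1], so both values are [a * dapp psi m1]. *)
- by rewrite /dapp /= /dual_comp -m1f1 -m1f2.
Qed.

Theorem theorem3p9 (R : pzRingType) (M : rmodType R)
    (regM : regular_module M) (m1 m2 : M) :
  minus_le m1 m2 <-> mitsch_le m1 m2.
Proof.
by split; [exact: minus_le_mitsch_le|exact/mitsch_le_minus_le/regM].
Qed.
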